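(* Let $\lambda=(\lambda_1,\ldots,\lambda_\ell)$ and $\mu$ be partitions. Then \[ h_\lambda[\Xi_\mu] \;=\; \sum_{\pi \,\vdash\!\!\vdash\, \{\!\!\{ 1^{\lambda_1},2^{\lambda_2},\ldots,\ell^{\lambda_\ell}\}\!\!\}} H_{\tilde m(\pi),\mu}, \] where the sum runs over all multiset partitions $\pi$ of the multiset $\{\!\!\{ 1^{\lambda_1},\ldots,\ell^{\lambda_\ell}\}\!\!\}$ and, for partitions $\nu,\mu$, $H_{\nu,\mu}:=\langle h_{|\mu|-|\nu|}h_\nu,\,p_\mu\rangle$.
   Context: $Sym=\mathbb{Q}[p_1,p_2,\ldots]$ is the ring of symmetric functions with power sums $p_k$, complete homogeneous functions $h_\lambda$, and the Hall inner product $\langle\cdot,\cdot\rangle$ with $\langle p_\lambda,p_\mu\rangle=z_\lambda\delta_{\lambda\mu}$; the convention $h_0=1$, $h_{-r}=0$ for $r>0$ is used (so $H_{\nu,\mu}=0$ when $|\nu|>|\mu|$). For $k>0$, $\Xi_k$ denotes the list $1,e^{2\pi i/k},\ldots,e^{2\pi i(k-1)/k}$ of eigenvalues of a $k$-cycle permutation matrix, and for a partition $\mu$, $\Xi_\mu$ is the concatenation of $\Xi_{\mu_1},\ldots,\Xi_{\mu_{\ell(\mu)}}$. For $f\in Sym$, $f[\Xi_\mu]$ is obtained by substituting for each $p_k$ the sum of the $k$-th powers of the entries of $\Xi_\mu$ (equivalently $p_k\mapsto\sum_{d\mid k} d\, m_d(\mu)$, where $m_d(\mu)$ is the number of parts of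 $\mu$ equal to $d$). A multiset partition of a multiset $S$ is a multiset of nonempty multisets whose multiset union is $S$. For a multiset partition $\pi$, $\tilde m(\pi)$ is the partition (of the number of parts of $\pi$) whose parts are the multiplicities with which the distinct multisets occur in $\pi$. *)

(* Defs.v *)
From mathcomp Require Import all_boot all_order all_algebra.
Set Implicit Arguments. Unset Strict Implicit. Unset Printing Implicit Defensive.
Import Order.TTheory GRing.Theory Num.Theory.
Local Open Scope ring_scope.

Definition is_partition (s : seq nat) : bool :=
  sorted geq s && all (fun x => (0 < x)%N) s.

(* partsb k m n : all partitions of n with parts <= m (k is fuel, k >= n). *)
Fixpoint partsb (k m n : nat) : seq (seq nat) :=
  if n == 0%N then [:: [::]] else
  match k with
  | 0 => [::]
  | k'.+1 => flatten [seq [seq p :: s | s <- partsb k' p (n - p)]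
                      | p <- iota 1 (minn m n)]
  end.

Definition partitions (n : nat) : seq (seq nat) := partsb n n n.

Definition zee (r : seq nat) : nat :=
  \prod_(1 <= i < (sumn r).+1) (i ^ count_mem i r * (count_mem i r)`!)%N.

(* An element of Sym = Q[p_1,p_2,...] is represented as a formal Q-linear
   combination of power sums p_rho, rho a partition: a list of pairs
   (rho, coefficient).  Duplicated entries are simply added. *)
Definition symf := seq (seq nat * rat).

Definition psort (s : seq nat) : seq nat := sort geq s.

(* product, using p_rho p_sigma = p_(rho U sigma) *)
Definition smul (f g : symf) : symf :=
  [seq (psort (x.1 ++ y.1), x.2 * y.2) | x <- f, y <- g].

Definition h_sym (n : nat) : symf :=
  [seq (r, ((zee r)%:R)^-1) | r <- partitions n].

Definition h_part (nu : seq nat) : symf :=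
  foldr (fun n f => smul (h_sym n) f) [:: ([::], 1)] nu.

(* Hall inner product <f, p_mu> (mu a partition), using <p_la,p_mu> = z_la d_la,mu *)
Definition hall_p (f : symf) (mu : seq nat) : rat :=
  \sum_(x <- f | x.1 == mu) x.2 * (zee mu)%:R.

(* ring homomorphism Sym -> Q given by p_k |-> P k *)
Definition sym_eval (P : nat -> rat) (f : symf) : rat :=
  \sum_(x <- f) x.2 * \prod_(k <- x.1) P k.

(* image of p_k under f |-> f[Xi_mu]:  sum_{d | k} d m_d(mu) *)
Definition Xi_p (mu : seq nat) (k : nat) : rat :=
  (\sum_(1 <= d < k.+1 | d %| k) d * count_mem d mu)%N%:R.

Definition pleth_Xi (f : symf) (mu : seq nat) : rat := sym_eval (Xi_p mu) f.

(* H_{nu,mu} = < h_{|mu|-|nu|} h_nu , p_mu >, with h_{-r} = 0 for r > 0 *)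
Definition Hnm (nu mu : seq nat) : rat :=
  if (sumn nu <= sumn mu)%N
  then hall_p (smul (h_sym (sumn mu - sumn nu)) (h_part nu)) mu
  else 0.

(* A (sub)multiset of {1,...,l} (l = size la) is its multiplicity function;
   element i+1 is indexed by i : 'I_l.  Multiplicities are bounded by |la|. *)
Definition mblock (la : seq nat) := {ffun 'I_(size la) -> 'I_(sumn la).+1}.

(* A multiset of such multisets is again a multiplicity function
   (multiplicities are bounded by |la|, since blocks are nonempty). *)
Definition mset_of_blocks (la : seq nat) := {ffun mblock la -> 'I_(sumn la).+1}.

Definition is_mset_partition (la : seq nat) (pi : mset_of_blocks la) : bool :=
  [forall b : mblock la, (pi b != ord0) ==> [exists i, b i != ord0]] &&
  [forall i : 'I_(size la),
     (\sum_(b : mblock la) pi b * b i)%N == nth 0%N la i].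

Definition mtilde (la : seq nat) (pi : mset_of_blocks la) : seq nat :=
  sort geq [seq nat_of_ord (pi b) | b <- enum (mblock la) & pi b != ord0].

(* Main.v *)
(* Let dsym k = k d/dp_k be the derivation adjoint to multiplication by p_k, so that
   dsym k h_n = h_(n-k).  Removing the parts of mu one at a time,
   <h_nu, p_(k,mu)> = <dsym k h_nu, p_mu> and the Leibniz rule show that
   <h_nu, p_mu> counts the assignments of the parts of mu to bins with loads nu;
   hence the right-hand side counts the assignments of (possibly empty) blocks B_j
   to the parts mu_j with sum_j mu_j B_j = {1^la_1, 2^la_2, ...}, the multiset
   partition recording the load of each nonempty block.  On the left, Euler's
   formula for dsym gives Newton's identity, whence sum_n h_n[Xi_mu] t^n =
   prod_j 1/(1 - t^mu_j), and prod_i h_(la_i)[Xi_mu] counts the same assignments. *)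
Require Import Defs.
From mathcomp Require Import all_boot all_order all_algebra.
From mathcomp Require Import zify ring.
Set Implicit Arguments. Unset Strict Implicit. Unset Printing Implicit Defensive.
Import Order.TTheory GRing.Theory Num.Theory.
Local Open Scope ring_scope.

(** * Partitions as sorted lists, and the numbers z_r *)

Lemma geq_total : total geq.
Proof. by move=> x y; exact: leq_total. Qed.

Lemma geq_trans : transitive geq.
Proof. by move=> y x z /= yx zy; exact: leq_trans zy yx. Qed.

Lemma geq_anti : antisymmetric geq.
Proof. by move=> x y /= /andP [? ?]; apply/eqP; rewrite eqn_leq; apply/andP. Qed.

Lemma perm_psort s : perm_eq (psort s) s.
Proof. by apply/permPl; exact: perm_sort. Qed.

Lemma psort_sorted s : sorted geq (psort s).
Proof. exact: sort_sorted geq_total _. Qed.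

Lemma sorted_geq_perm_eq s t :
  sorted geq s -> sorted geq t -> perm_eq s t -> s = t.
Proof. exact: sorted_eq geq_trans geq_anti _ _. Qed.

Lemma mem_partsb k m n s : (n <= k)%N ->
  (s \in partsb k m n) =
  [&& path geq m s, all (fun x => 0 < x)%N s & sumn s == n].
Proof.
elim: k m n s => [|k IH] m n s nk.
  have -> : n = 0%N by lia.
  rewrite /= inE; case: s => [|p s] //=.
  by apply/esym/negP => /and3P [_ /andP [p0 _] /eqP]; lia.
rewrite /=; case: eqP => [->|n0].
  rewrite inE; case: s => [|p s] //=.
  by apply/esym/negP => /and3P [_ /andP [p0 _] /eqP]; lia.
apply/flattenP/idP => [[ss /mapP [p]]|].
  rewrite mem_iota => pr -> /mapP [t]; rewrite IH; last by lia.
  move=> /and3P [pt at_ /eqP st] -> /=; rewrite pt at_.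
  by apply/and3P; split; [|apply/andP; split|apply/eqP]; lia.
case: s => [|p s] /=; first by move/eqP; lia.
case/and3P => /andP [mp ps] /andP [p0 al] /eqP sn.
exists [seq p :: s | s <- partsb k p (n - p)].
  by apply/mapP; exists p => //; rewrite mem_iota; lia.
apply/mapP; exists s => //; rewrite IH; last by lia.
by rewrite ps al /=; apply/eqP; lia.
Qed.

Lemma partsb_uniq k m n : uniq (partsb k m n).
Proof.
elim: k m n => [|k IH] m n /=; first by case: ifP.
case: ifP => // _.
apply: allpairs_uniq_dep => [|p _|]; [exact: iota_uniq | exact: IH |].
by move=> [p s] [q t] _ _ /= [-> ->].
Qed.

Lemma partitions_uniq n : uniq (partitions n).
Proof. exact: partsb_uniq. Qed.

Lemma mem_partitions n s : (s \in partitions n) = is_partition s && (sumn s == n).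
Proof.
rewrite /partitions mem_partsb // /is_partition -andbA.
case: s => [|p s] //=; case: eqP => [<-|]; rewrite ?andbF // !andbT.
by have -> : (p <= p + sumn s)%N by lia.
Qed.

Lemma is_partition_perm_eq s t :
  is_partition s -> is_partition t -> perm_eq s t -> s = t.
Proof. by move=> /andP [ss _] /andP [st _]; exact: sorted_geq_perm_eq. Qed.

Lemma is_partition_psort s :
  all (fun x => 0 < x)%N s -> is_partition (psort s).
Proof.
by move=> al; rewrite /is_partition psort_sorted /= (perm_all _ (perm_psort s)).
Qed.

Lemma is_partition_rem k s : is_partition s -> is_partition (rem k s).
Proof.
move=> /andP [ss al]; rewrite /is_partition.
rewrite (subseq_sorted geq_trans (rem_subseq k s)) //=.
by apply/allP => x /mem_rem; move/allP: al; exact.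
Qed.

Lemma sumn_perm s t : perm_eq s t -> sumn s = sumn t.
Proof. by move=> st; rewrite !sumnE; exact: perm_big. Qed.

Lemma sumn_rem k s : k \in s -> sumn s = (k + sumn (rem k s))%N.
Proof. by move=> /perm_to_rem /sumn_perm. Qed.

Lemma count_gt_sumn i s : (sumn s < i)%N -> count_mem i s = 0%N.
Proof.
by elim: s => [|p s IH] //= lt; rewrite IH; last lia; case: eqP => //; lia.
Qed.

(** Indices beyond [sumn r] contribute i^0 * 0! = 1; a common range makes lists of different sums
    comparable. *)
Lemma zee_bound N r : (sumn r <= N)%N ->
  zee r = (\prod_(1 <= i < N.+1) (i ^ count_mem i r * (count_mem i r)`!))%N.
Proof.
move=> le; rewrite /zee [RHS](@big_cat_nat _ _ _ (sumn r).+1) //=.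
rewrite [X in (_ * X)%N]big_nat_cond [X in (_ * X)%N]big1 ?muln1 // => i.
by rewrite andbT => /andP [lt _]; rewrite count_gt_sumn.
Qed.

Lemma zee_perm r s : perm_eq r s -> zee r = zee s.
Proof.
move=> rs; rewrite /zee (sumn_perm rs); apply: eq_bigr => i _.
by move/permP: rs => /(_ (pred1 i)) ->.
Qed.

(** Only the factor at i = k changes, from k^m m! to k^(m+1) (m+1)!. *)
Lemma zee_cons k r : (0 < k)%N -> zee (k :: r) = (k * (count_mem k r).+1 * zee r)%N.
Proof.
move=> k0; have le : (sumn r <= k + sumn r)%N by lia.
rewrite (zee_bound le) /zee /=.
have kin : k \in index_iota 1 (k + sumn r).+1 by rewrite mem_index_iota; lia.
rewrite !(bigD1_seq k kin (iota_uniq _ _)) /= eqxx add1n factS expnS.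
rewrite (eq_bigr (fun i => i ^ count_mem i r * (count_mem i r)`!)%N); last first.
  by move=> i ik; rewrite [k == i]eq_sym (negPf ik) add0n.
by ring.
Qed.

(** * Linear functionals on Sym and equality of symmetric functions *)

Definition linfun_symf (phi : seq nat -> rat) (f : symf) : rat :=
  \sum_(x <- f) x.2 * phi x.1.

(** Such a [phi] depends only on the monomial p_r and not on the order of [r], so the sorting in
    [smul] is invisible to it. *)
Definition perm_invariant (phi : seq nat -> rat) :=
  forall s t, perm_eq s t -> phi s = phi t.

Lemma linfun_smul phi f g : perm_invariant phi ->
  linfun_symf phi (smul f g) =
  linfun_symf (fun r => linfun_symf (fun s => phi (r ++ s)) g) f.
Proof.
move=> hphi; rewrite /linfun_symf /smul big_allpairs_dep.
apply: eq_bigr => x _; rewrite mulr_sumr; apply: eq_bigr => y _ /=.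
by rewrite (hphi _ _ (perm_psort _)) mulrA.
Qed.

Lemma perm_invariant_catr phi s : perm_invariant phi ->
  perm_invariant (fun r => phi (r ++ s)).
Proof. by move=> h r t rt; apply: h; rewrite perm_cat2r. Qed.

Lemma perm_invariant_catl phi s : perm_invariant phi ->
  perm_invariant (fun r => phi (s ++ r)).
Proof. by move=> h r t rt; apply: h; rewrite perm_cat2l. Qed.

Lemma perm_invariant_linfun phi g : perm_invariant phi ->
  perm_invariant (fun r => linfun_symf (fun s => phi (r ++ s)) g).
Proof.
move=> h r t rt; apply: eq_bigr => x _.
by rewrite (perm_invariant_catr x.1 h rt).
Qed.

(** Equality in Sym: a [symf] may repeat and reorder its terms, so elements are compared through all
    functionals on monomials. *)
Definition sym_equiv (f g : symf) :=
  forall phi, perm_invariant phi -> linfun_symf phi f = linfun_symf phi g.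

Lemma sym_equiv_trans f g h : sym_equiv f g -> sym_equiv g h -> sym_equiv f h.
Proof. by move=> fg gh phi hphi; rewrite fg ?gh. Qed.

Lemma sym_equiv_sym f g : sym_equiv f g -> sym_equiv g f.
Proof. by move=> fg phi hphi; rewrite fg. Qed.

Lemma smul_equivr f g g' : sym_equiv g g' -> sym_equiv (smul f g) (smul f g').
Proof.
move=> gg phi hphi; rewrite !linfun_smul //; apply: eq_bigr => x _.
by congr (_ * _); apply: gg; exact: perm_invariant_catl.
Qed.

Lemma linfun_smul3 phi f g h : perm_invariant phi ->
  linfun_symf phi (smul f (smul g h)) =
  \sum_(x <- f) \sum_(y <- g) \sum_(z <- h)
    x.2 * y.2 * z.2 * phi (x.1 ++ y.1 ++ z.1).
Proof.
move=> hphi; rewrite linfun_smul //; apply: eq_bigr => x _.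
rewrite linfun_smul; last exact: perm_invariant_catl.
rewrite mulr_sumr; apply: eq_bigr => y _; rewrite !mulr_sumr.
by apply: eq_bigr => z _; rewrite !mulrA.
Qed.

Lemma smulCA f g h : sym_equiv (smul f (smul g h)) (smul g (smul f h)).
Proof.
move=> phi hphi; rewrite !linfun_smul3 // exchange_big /=.
apply: eq_bigr => y _; apply: eq_bigr => x _; apply: eq_bigr => z _.
rewrite (hphi _ (y.1 ++ x.1 ++ z.1)) ?[x.2 * _]mulrC //.
by apply/permPl; exact: perm_catCA.
Qed.

Lemma h_sym0 : h_sym 0 = [:: ([::], 1)].
Proof. by rewrite /h_sym /= /zee big_geq // invr1. Qed.

Lemma h_part_cons0 s : sym_equiv (h_part (0%N :: s)) (h_part s).
Proof.
move=> phi hphi; rewrite [h_part (_ :: _)]/= -/(h_part s) h_sym0 linfun_smul //.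
by rewrite /linfun_symf big_seq1 mul1r.
Qed.

Lemma h_part_rem n s : n \in s -> sym_equiv (h_part s) (h_part (n :: rem n s)).
Proof.
elim: s => [|m s IH] // ns /=; case: eqP => [<-|nm]; first by [].
have {}ns : n \in s by move: ns; rewrite inE eq_sym; case: eqP.
apply: sym_equiv_trans (smul_equivr _ (IH ns)) _; exact: smulCA.
Qed.

Lemma h_part_perm s t : perm_eq s t -> sym_equiv (h_part s) (h_part t).
Proof.
elim: s t => [|n s IH] t st.
  by move: (perm_size st) => /esym /size0nil ->.
have nt : n \in t by rewrite -(perm_mem st) mem_head.
apply: sym_equiv_trans (sym_equiv_sym (h_part_rem nt)).
by apply/smul_equivr/IH; rewrite -(perm_cons n) (perm_trans st) ?perm_to_rem.
Qed.

Lemma h_part_filter s :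
  sym_equiv (h_part [seq n <- s | n != 0%N]) (h_part s).
Proof.
elim: s => [|[|n] s IH] //=; last exact: smul_equivr.
exact: sym_equiv_trans IH (sym_equiv_sym (@h_part_cons0 s)).
Qed.

Lemma h_part_sorted s : all (fun x => sorted geq x.1) (h_part s).
Proof.
case: s => [|n s] //; apply/allP => x /allpairsP [p [_ _ ->]].
exact: psort_sorted.
Qed.

(** * The derivation adjoint to p_k *)

(* The derivation k * d/dp_k, adjoint to multiplication by p_k. *)
Definition dsym (k : nat) (f : symf) : symf :=
  [seq (rem k x.1, x.2 * (k * count_mem k x.1)%:R) | x <- f].

Lemma linfun_dsym phi k f : linfun_symf phi (dsym k f) =
  \sum_(x <- f) x.2 * (k * count_mem k x.1)%:R * phi (rem k x.1).
Proof. by rewrite /linfun_symf big_map. Qed.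

Lemma perm_rem_cat k (r s : seq nat) : k \in r -> perm_eq (rem k (r ++ s)) (rem k r ++ s).
Proof.
move=> kr; have krs : k \in r ++ s by rewrite mem_cat kr.
rewrite -(perm_cons k) -cat_cons; apply: (@perm_trans _ (r ++ s)).
  by rewrite perm_sym perm_to_rem.
by rewrite perm_cat2r perm_to_rem.
Qed.

Lemma perm_rem k (r s : seq nat) : perm_eq r s -> perm_eq (rem k r) (rem k s).
Proof.
move=> rs; case kr: (k \in r); last first.
  by rewrite !rem_id // -?(perm_mem rs) kr.
rewrite -(perm_cons k); apply: (@perm_trans _ r).
  by rewrite perm_sym perm_to_rem.
by apply: (perm_trans rs); rewrite perm_to_rem // -(perm_mem rs).
Qed.

(** Leibniz rule: the multiplicity of k in a concatenation is the sum of the two multiplicities, and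
    each copy of k can be removed from the factor it lies in. *)
Lemma dsym_smul phi k f g : perm_invariant phi ->
  linfun_symf phi (dsym k (smul f g)) =
  linfun_symf phi (smul (dsym k f) g) + linfun_symf phi (smul f (dsym k g)).
Proof.
move=> h; rewrite !linfun_smul // linfun_dsym {1}/smul big_allpairs_dep.
rewrite linfun_dsym /linfun_symf -big_split /=; apply: eq_bigr => x _.
rewrite /dsym big_map /= !mulr_sumr -big_split /=.
apply: eq_bigr => y _.
rewrite (h _ _ (perm_rem k (perm_psort _))).
have -> : count_mem k (psort (x.1 ++ y.1)) = (count_mem k x.1 + count_mem k y.1)%N.
  by rewrite -count_cat; apply/permP; exact: perm_psort.
rewrite mulnDr natrD mulrDr mulrDl; congr (_ + _).
  case kx: (k \in x.1); last first.
    by rewrite (count_memPn _) ?kx // muln0 !(mulr0, mul0r).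
  by rewrite (h _ _ (perm_rem_cat _ kx)); ring.
case ky: (k \in y.1); last first.
  by rewrite (count_memPn _) ?ky // muln0 !(mulr0, mul0r).
rewrite (h _ (x.1 ++ rem k y.1)); first by ring.
apply: perm_trans (perm_rem k _) _; first by rewrite perm_catC.
by apply: perm_trans (perm_rem_cat _ ky) _; rewrite perm_catC.
Qed.

(** Inserting a part k maps the partitions r of n - k bijectively onto the partitions of n
    containing k, and the weight k (m_k(r) + 1) cancels the quotient of the two z-numbers. *)
Lemma dsym_h phi k n : (0 < k)%N -> perm_invariant phi ->
  linfun_symf phi (dsym k (h_sym n)) =
  if (k <= n)%N then linfun_symf phi (h_sym (n - k)) else 0.
Proof.
move=> k0 h; rewrite linfun_dsym /h_sym big_map /=.
rewrite (bigID (fun r => k \in r)) /= [X in _ + X]big1 ?addr0; last first.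
  by move=> r kr; rewrite (count_memPn _) // muln0 mulr0 mul0r.
case: ifP => [kn|/negbT nk]; last first.
  rewrite big_seq_cond big1 // => r /andP [].
  rewrite mem_partitions => /andP [_ /eqP sr] /sumn_rem; lia.
rewrite /linfun_symf big_map -big_filter.
have pe : perm_eq [seq r <- partitions n | k \in r]
                  [seq psort (k :: r) | r <- partitions (n - k)].
  apply: uniq_perm; first by rewrite filter_uniq ?partitions_uniq.
    rewrite map_inj_in_uniq ?partitions_uniq // => r s.
    rewrite !mem_partitions => /andP [pr _] /andP [ps _] e.
    apply: is_partition_perm_eq => //; rewrite -(perm_cons k).
    by apply: perm_trans (perm_psort _); rewrite -e perm_sym perm_psort.
  move=> r; rewrite mem_filter mem_partitions; apply/idP/mapP.
    move=> /and3P [kr pr /eqP sr]; exists (rem k r).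
      rewrite mem_partitions is_partition_rem //=.
      by have := sumn_rem kr; lia.
    apply: is_partition_perm_eq => //.
      apply: is_partition_psort; move: pr => /andP [_ al] /=; rewrite k0.
      by apply/allP => x /mem_rem; move/allP: al; exact.
    by rewrite perm_sym (perm_trans (perm_psort _)) // perm_sym perm_to_rem.
  move=> [s]; rewrite mem_partitions => /andP [/andP [_ al] /eqP ss] ->.
  rewrite (perm_mem (perm_psort _)) mem_head /= is_partition_psort /= ?k0 //=.
  by rewrite (sumn_perm (perm_psort _)) /=; apply/eqP; lia.
rewrite (perm_big _ pe) big_map; apply: eq_bigr => r _ /=.
rewrite (zee_perm (perm_psort _)) zee_cons //.
have -> : count_mem k (psort (k :: r)) = (count_mem k r).+1.
  by move/permP: (perm_psort (k :: r)) => ->; rewrite /= eqxx.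
rewrite (h _ r); last first.
  by apply: perm_trans (perm_rem k (perm_psort _)) _; rewrite /= eqxx.
have c0 : (k * (count_mem k r).+1)%:R != 0 :> rat by rewrite pnatr_eq0; lia.
by rewrite natrM; congr (_ * _); rewrite invfM mulrC mulrA divff ?mul1r.
Qed.

(** Iterated Leibniz rule. Factors are labelled by distinct elements of [s], so that equal values of
    [nu] remain separate bins. *)
Lemma dsym_h_part (T : eqType) phi k (nu : T -> nat) (s : seq T) :
  (0 < k)%N -> perm_invariant phi -> uniq s ->
  linfun_symf phi (dsym k (h_part (map nu s))) =
  \sum_(b <- s) if (k <= nu b)%N
    then linfun_symf phi (h_part [seq (nu c - k * (c == b))%N | c <- s]) else 0.
Proof.
move=> k0; elim: s phi => [|a s IH] phi hphi /=.
  by move=> _; rewrite big_nil /linfun_symf big_seq1 /= muln0 mulr0 mul0r.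
move=> /andP [as_ us]; rewrite dsym_smul // big_cons; congr (_ + _).
  rewrite linfun_smul // dsym_h //; last exact: perm_invariant_linfun.
  rewrite -linfun_smul // eqxx muln1; case: ifP => // _.
  congr (linfun_symf _ (smul _ (h_part _))); apply/eq_in_map => c cs.
  by case: eqP as_ cs => [->|_ _ _] /=; [move/negP | rewrite muln0 subn0].
rewrite linfun_smul //; etransitivity.
  apply: eq_bigr => x _.
  by rewrite (IH _ (perm_invariant_catl _ hphi) us) mulr_sumr; reflexivity.
rewrite exchange_big /=; apply: eq_big_seq => b bs.
have -> : (a == b) = false by apply/eqP => ab; move: as_; rewrite ab bs.
rewrite muln0 subn0; case: ifP => kb; last by rewrite big1 // => x _; rewrite mulr0.
by rewrite linfun_smul.
Qed.

(** * The Hall pairing with p_mu *)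

Definition hall_fun (mu r : seq nat) : rat := (perm_eq r mu)%:R * (zee mu)%:R.

Lemma hall_fun_perm mu : perm_invariant (hall_fun mu).
Proof.
move=> s t st; congr (_%:R * _); congr nat_of_bool.
by move/permPl: st => ->.
Qed.

(** On sorted lists the [perm_eq] of [hall_fun], chosen for permutation invariance, coincides with
    equality. *)
Lemma hall_p_linfun f mu : all (fun x => sorted geq x.1) f -> sorted geq mu ->
  hall_p f mu = linfun_symf (hall_fun mu) f.
Proof.
move=> /allP sf smu; rewrite /hall_p big_mkcond; apply: eq_big_seq => x xf.
rewrite /hall_fun; case: eqP => [->|ne]; first by rewrite perm_refl mul1r.
case: (boolP (perm_eq _ _)) => [pe|_]; last by rewrite mul0r mulr0.
by case: ne; apply: sorted_geq_perm_eq => //; exact: sf.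
Qed.

(** Adjointness: a monomial matching k :: mu contains k exactly m_k(mu) + 1 times, and z_(k,mu) = k
    (m_k(mu) + 1) z_mu. *)
Lemma hall_fun_cons k mu f : (0 < k)%N ->
  linfun_symf (hall_fun (k :: mu)) f = linfun_symf (hall_fun mu) (dsym k f).
Proof.
move=> k0; rewrite linfun_dsym; apply: eq_bigr => x _; rewrite /hall_fun.
case kx: (k \in x.1); last first.
  rewrite (count_memPn _) ?kx // muln0 mulr0 mul0r.
  case: (boolP (perm_eq _ _)) => [pe|_]; last by rewrite mul0r mulr0.
  by move: kx; rewrite (perm_mem pe) mem_head.
have e : perm_eq x.1 (k :: mu) = perm_eq (rem k x.1) mu.
  by rewrite -[RHS](perm_cons k); move/permPl: (perm_to_rem kx) => ->.
rewrite -e; case: (boolP (perm_eq _ _)) => [pe|_]; last by rewrite !mul0r !mulr0.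
move/permP: (pe) => ->; rewrite zee_cons //= eqxx add1n !mul1r -mulrA.
by rewrite -natrM.
Qed.

(** * Evaluation homomorphisms *)

Lemma sym_eval_smul P f g :
  sym_eval P (smul f g) = sym_eval P f * sym_eval P g.
Proof.
rewrite -[LHS]/(linfun_symf (fun r => \prod_(k <- r) P k) _) linfun_smul; last first.
  by move=> s t st; exact: perm_big.
rewrite /sym_eval mulr_suml; apply: eq_bigr => x _; rewrite -mulrA; congr (_ * _).
rewrite /linfun_symf mulr_sumr; apply: eq_bigr => y _.
by rewrite big_cat mulrCA.
Qed.

Lemma sym_eval_h_part P s :
  sym_eval P (h_part s) = \prod_(n <- s) sym_eval P (h_sym n).
Proof.
elim: s => [|n s IH] /=; first by rewrite /sym_eval big_seq1 !big_nil mulr1.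
by rewrite sym_eval_smul big_cons IH.
Qed.

Lemma sym_eval_h0 P : sym_eval P (h_sym 0) = 1.
Proof. by rewrite h_sym0 /sym_eval big_seq1 big_nil mulr1. Qed.

Lemma sym_eval_zero P n : (forall k, P k = 0) ->
  sym_eval P (h_sym n) = (n == 0%N)%:R.
Proof.
move=> P0; case: n => [|n]; first by rewrite sym_eval_h0.
rewrite /sym_eval big_map big_seq big1 // => -[|p r].
  by rewrite mem_partitions.
by rewrite big_cons P0 mul0r mulr0.
Qed.

(** * Assignments of the parts of mu to bins *)

Fixpoint assignments (I : finType) (n : nat) : seq (seq I) :=
  if n is n'.+1 then [seq b :: B | b <- enum I, B <- assignments I n'] else [:: [::]].

Lemma size_assignments (I : finType) n B : B \in assignments I n -> size B = n.
Proof.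
elim: n B => [|n IH] B /=; first by rewrite inE => /eqP ->.
by case/allpairsP => -[b C] /= [_ /IH <- ->].
Qed.

(** With [w] the indicator of b this is the load of bin b; with [w] the multiplicity of a letter in
    a block it is the total content of that letter. *)
Definition wsum (I : Type) (mu : seq nat) (B : seq I) (w : I -> nat) : nat :=
  \sum_(x <- zip mu B) x.1 * w x.2.

Lemma wsum_cons (I : Type) k mu (b : I) B w :
  wsum (k :: mu) (b :: B) w = (k * w b + wsum mu B w)%N.
Proof. by rewrite /wsum /= big_cons. Qed.

Lemma wsum_nil (I : Type) (B : seq I) w : wsum [::] B w = 0%N.
Proof. by rewrite /wsum; case: B => [|b B]; rewrite big_nil. Qed.

Lemma wsum_split (I : finType) mu (B : seq I) w :
  wsum mu B w = (\sum_b wsum mu B (fun c => c == b) * w b)%N.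
Proof.
rewrite /wsum; under [RHS]eq_bigr do rewrite big_distrl /=.
rewrite exchange_big /=; apply: eq_bigr => x _.
rewrite (bigD1 x.2) //= eqxx muln1 big1 ?addn0 // => b /negPf bx.
by rewrite eq_sym bx muln0.
Qed.

Lemma wsum_total (I : finType) mu (B : seq I) : size B = size mu ->
  (\sum_b wsum mu B (fun c => c == b))%N = sumn mu.
Proof.
move=> sB; transitivity (wsum mu B (fun _ => 1%N)).
  by rewrite wsum_split; apply: eq_bigr => b _; rewrite muln1.
elim: mu B sB => [|k mu IH] [|b B] //=; first by rewrite wsum_nil.
by move=> [/IH e]; rewrite wsum_cons e muln1.
Qed.

(** Induction on mu: pairing with p_k subtracts k from one bin, and the choice of that bin is the
    head of the assignment. *)
Lemma hall_h_part (I : finType) (nu : I -> nat) mu :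
  all (fun x => 0 < x)%N mu ->
  linfun_symf (hall_fun mu) (h_part (map nu (enum I))) =
  \sum_(B <- assignments I (size mu))
    [forall b, wsum mu B (fun c => c == b) == nu b]%:R.
Proof.
elim: mu nu => [|k mu IH] nu /=.
  move=> _; rewrite big_seq1.
  (* Pairing with the empty monomial extracts the constant term, that is, evaluates at p_k = 0 for
     all k. *)
  transitivity (sym_eval (fun _ => 0) (h_part (map nu (enum I)))).
    apply: eq_bigr => x _; congr (_ * _); rewrite /hall_fun /zee big_geq // mulr1.
    case: x.1 => [|p r]; first by rewrite big_nil.
    by rewrite big_cons mul0r; case: (boolP (perm_eq _ _)) => // /perm_size.
  rewrite sym_eval_h_part big_map.
  under eq_bigr => b _ do rewrite sym_eval_zero //.
  case: (boolP [forall b, _]) => [/forallP h|].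
    by rewrite big1 // => b _; move: (h b); rewrite wsum_nil eq_sym => /eqP ->.
  rewrite negb_forall => /existsP [b]; rewrite wsum_nil eq_sym => /negPf nb.
  by rewrite (bigD1_seq b) ?mem_enum ?enum_uniq //= nb mul0r.
move=> /andP [k0 amu].
rewrite hall_fun_cons // dsym_h_part ?enum_uniq //; last exact: hall_fun_perm.
rewrite big_allpairs_dep; apply: eq_bigr => b _.
(* A part k exceeding [nu b] cannot be placed in bin b. *)
rewrite IH //; case: ifP => kb; last first.
  rewrite big1 // => B _; case: (boolP [forall c, _]) => // /forallP /(_ b).
  by rewrite wsum_cons eqxx muln1 => /eqP; lia.
apply: eq_bigr => B _; congr (nat_of_bool _)%:R; apply: eq_forallb => c.
rewrite wsum_cons eq_sym [b == c]eq_sym.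
case: (eqVneq c b) => [->|_]; rewrite ?muln1 ?muln0 ?subn0 1?eq_sym //.
by apply/eqP/eqP; lia.
Qed.

(** The factor h_(|mu|-|nu|) is the bin [b0], whose load is unconstrained because the other loads
    determine it. Later [b0] is the empty block. *)
Lemma Hnm_count (I : finType) (b0 : I) (pi : I -> nat) mu :
  pi b0 = 0%N -> is_partition mu ->
  Hnm (psort [seq pi b | b <- enum I & pi b != 0%N]) mu =
  \sum_(B <- assignments I (size mu))
    [forall b, (b != b0) ==> (wsum mu B (fun c => c == b) == pi b)]%:R.
Proof.
move=> pi0 /andP [smu amu]; set nu := psort _.
have enu : sumn nu = (\sum_(b | b != b0) pi b)%N.
  rewrite (sumn_perm (perm_psort _)) sumnE big_map big_filter big_enum_cond /=.
  rewrite [RHS]big_mkcond [LHS]big_mkcond; apply: eq_bigr => b _ /=.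
  by case: (eqVneq b b0) => [->|_]; rewrite ?pi0 //=; case: eqP => [->|].
(* When |nu| > |mu|, the prescribed loads outside [b0] exceed the total |mu|, so no assignment is
   counted. *)
rewrite /Hnm; case: ifP => le; last first.
  rewrite big_seq big1 // => B /size_assignments sB.
  case: (boolP [forall c, _]) => // /forallP h.
  have := wsum_total sB; rewrite (bigD1 b0) //= => e.
  suff e2 : (\sum_(b | b != b0) wsum mu B (fun c => c == b) = sumn nu)%N.
    by move: e le; rewrite e2; lia.
  by rewrite enu; apply: eq_bigr => b bb; apply/eqP; move: (h b); rewrite bb.
pose nu' b := if b == b0 then (sumn mu - sumn nu)%N else pi b.
rewrite hall_p_linfun //; last exact: (h_part_sorted (_ :: nu)).
have b0e : b0 \in enum I by rewrite mem_enum.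
have -> : linfun_symf (hall_fun mu) (smul (h_sym (sumn mu - sumn nu)) (h_part nu))
        = linfun_symf (hall_fun mu) (h_part (map nu' (enum I))).
  (* Bins of load 0 can be restored since h_0 = 1. *)
  transitivity (linfun_symf (hall_fun mu)
      (h_part ((sumn mu - sumn nu)%N :: map pi (rem b0 (enum I))))).
    apply: smul_equivr; last exact: hall_fun_perm.
    apply: sym_equiv_trans (h_part_perm (perm_psort _)) _.
    rewrite -(filter_map pi (fun n => n != 0%N)).
    apply: sym_equiv_trans (h_part_filter _) _.
    apply: sym_equiv_trans (h_part_cons0 _); apply: h_part_perm.
    by rewrite -pi0 -map_cons; apply: perm_map; rewrite perm_to_rem.
  apply: h_part_perm; last exact: hall_fun_perm.
  rewrite perm_sym; apply: perm_trans (perm_map _ (perm_to_rem b0e)) _ => /=.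
  rewrite {1}/nu' eqxx perm_cons.
  rewrite (_ : map nu' _ = map pi (rem b0 (enum I))) //; apply/eq_in_map => b.
  by rewrite mem_rem_uniq ?enum_uniq // inE /nu' => /andP [/negPf ->].
rewrite hall_h_part //; apply: eq_big_seq => B /size_assignments sB.
congr (nat_of_bool _)%:R; apply/forallP/forallP => h b.
  by apply/implyP => /negPf bb; move: (h b); rewrite /nu' bb.
rewrite /nu'; case: (eqVneq b b0) => [->|bb]; last by move: (h b); rewrite bb.
have := wsum_total sB; rewrite (bigD1 b0) //= => e.
have : (\sum_(b | b != b0) wsum mu B (fun c => c == b) = sumn nu)%N.
  by rewrite enu; apply: eq_bigr => c cc; apply/eqP; move: (h c); rewrite cc.
by move=> e2; apply/eqP; move: e le; rewrite e2; lia.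
Qed.

(** * Newton's identity and its solutions *)

Lemma sum_count_mem N r : all (fun x => 0 < x)%N r -> (sumn r <= N)%N ->
  (\sum_(1 <= k < N.+1) k * count_mem k r)%N = sumn r.
Proof.
elim: r => [|p r IH] /=; first by move=> _ _; rewrite big1 // => k _; rewrite muln0.
move=> /andP [p0 ar] le; under eq_bigr do rewrite mulnDr.
rewrite big_split /= IH //; last by lia.
rewrite (bigD1_seq p) ?iota_uniq ?mem_index_iota //=; last by lia.
rewrite eqxx muln1 big1 ?addn0 // => k /negPf kp.
by rewrite eq_sym kp muln0.
Qed.

(* Newton's identity, read off Euler's formula n h_n = sum_k p_k (dsym k h_n). *)
Lemma sym_eval_newton P n :
  n%:R * sym_eval P (h_sym n) =
  \sum_(1 <= k < n.+1) P k * sym_eval P (h_sym (n - k)).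
Proof.
pose phi (r : seq nat) : rat := \prod_(k <- r) P k.
have hphi : perm_invariant phi by move=> s t st; exact: perm_big.
transitivity (\sum_(1 <= k < n.+1) P k * linfun_symf phi (dsym k (h_sym n))); last first.
  rewrite !big_nat; apply: eq_bigr => k /andP [k0 kn].
  by rewrite dsym_h // -ltnS kn.
under eq_bigr do rewrite linfun_dsym big_map mulr_sumr /=.
rewrite exchange_big /sym_eval big_map mulr_sumr /=; apply: eq_big_seq => r.
rewrite mem_partitions => /andP [/andP [_ ar] /eqP sr].
(* Multiplying by [P k] restores the removed part, and the weights k m_k(r) add up to n. *)
transitivity (\sum_(1 <= k < n.+1) (zee r)%:R^-1 * phi r * (k * count_mem k r)%:R).
  rewrite -mulr_sumr -natr_sum sum_count_mem ?sr // mulrC; congr (_ * _).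
apply: eq_bigr => k _; case kr: (k \in r); last first.
  by rewrite (count_memPn _) ?kr // muln0 !(mulr0, mul0r).
rewrite (hphi _ _ (perm_to_rem kr)) {1}/phi big_cons -/(phi _).
by ring.
Qed.

(** For n > 0 the recursion involves only smaller indices on the right and n is invertible, so the
    initial value determines the sequence. *)
Lemma newton_unique (P a c : nat -> rat) : a 0%N = c 0%N ->
  (forall n, n%:R * a n = \sum_(1 <= k < n.+1) P k * a (n - k)%N) ->
  (forall n, n%:R * c n = \sum_(1 <= k < n.+1) P k * c (n - k)%N) ->
  a =1 c.
Proof.
move=> e0 ha hc n; have [m] := ubnP n; elim: m n => // m IH [|n] lt //.
have n0 : n.+1%:R != 0 :> rat by rewrite pnatr_eq0.
apply: (mulfI n0); rewrite ha hc !big_nat; apply: eq_bigr => k /andP [k0 kn].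
by rewrite IH //; lia.
Qed.

(* Coefficientwise form of: multiplying exp (sum_k P_k t^k / k) by (1 - t^d)^-1
   adds d to P_k whenever d divides k. *)
Lemma newton_geometric (P P' a b : nat -> rat) d : (0 < d)%N ->
  a 0%N = b 0%N ->
  (forall k, (0 < k)%N -> P' k = P k + (if (d %| k)%N then d%:R else 0)) ->
  (forall n, n%:R * a n = \sum_(1 <= k < n.+1) P k * a (n - k)%N) ->
  (forall n, n%:R * b n = \sum_(1 <= k < n.+1) P' k * b (n - k)%N) ->
  forall n, b n = a n + (if (d <= n)%N then b (n - d)%N else 0).
Proof.
move=> d0 e0 hP ha hb.
(* As series, [x] is d t^d / (1 - t^d), the increment from P to P', and [sh] is t^d b(t). *)
pose x k : rat := if (d %| k)%N then d%:R else 0.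
pose sh n := if (d <= n)%N then b (n - d)%N else 0.
have cut (Q : nat -> rat) n : (d <= n)%N ->
    \sum_(1 <= k < n.+1) Q k * sh (n - k)%N =
    \sum_(1 <= k < (n - d).+1) Q k * b (n - d - k)%N.
  move=> dn; rewrite (@big_cat_nat _ _ _ (n - d).+1) //=; last by lia.
  rewrite [X in _ + X]big_nat [X in _ + X]big1 ?addr0.
    rewrite !big_nat; apply: eq_bigr => k /andP [k0 kn].
    rewrite /sh (_ : (d <= n - k)%N); last by lia.
    by congr (_ * b _); lia.
  move=> k /andP [k1 k2]; rewrite /sh (_ : (d <= n - k)%N = false) ?mulr0 //; lia.
(* Product rule for t d/dt applied to t^d b(t). *)
have hsh n : n%:R * sh n =
    \sum_(1 <= k < n.+1) P' k * sh (n - k)%N + d%:R * sh n.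
  case: (leqP d n) => dn; last first.
    have z m : (m <= n)%N -> sh m = 0.
      by move=> mn; rewrite /sh (_ : (d <= m)%N = false) //; lia.
    rewrite z // !mulr0 big1 ?addr0 // => k _.
    by rewrite z ?mulr0 // leq_subr.
  rewrite cut // -hb /sh dn -mulrDl -natrD subnK //.
(* This is x = t^d x + d t^d multiplied by b(t). *)
have hx n : \sum_(1 <= k < n.+1) x k * b (n - k)%N =
    \sum_(1 <= k < n.+1) x k * sh (n - k)%N + d%:R * sh n.
  have xlt k : (0 < k < d)%N -> x k = 0.
    by move=> /andP [k0 kd]; rewrite /x gtnNdvd.
  case: (leqP d n) => dn; last first.
    rewrite {2}/sh leqNgt dn mulr0 addr0 !big_nat; apply: eq_bigr => k kn.
    by rewrite xlt ?mul0r //; lia.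
  rewrite cut // (@big_cat_nat _ _ _ d) //=; last by lia.
  rewrite big_nat big1 ?add0r; last by move=> k kd; rewrite xlt ?mul0r.
  rewrite big_ltn; last by lia.
  rewrite addrC {2}/x dvdnn /sh dn; congr (_ + _).
  rewrite -{1}(add1n d) big_addn subSn //; apply: eq_bigr => k _.
  rewrite /x dvdn_addl //; congr (_ * b _); lia.
(* The series (1 - t^d) b(t) satisfies the recursion for P, so uniqueness identifies it with
   a(t). *)
suff e n : a n = b n - sh n by move=> n; rewrite e subrK.
apply: (@newton_unique P a (fun n => b n - sh n)) => //.
  by rewrite /sh leqn0 (gtn_eqF d0) subr0.
move=> {}n; rewrite mulrBr hb hsh.
under eq_big_nat => k /andP [k0 _] do rewrite hP // mulrDl.
under [X in _ - (X + _)]eq_big_nat => k /andP [k0 _] do rewrite hP // mulrDl.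
rewrite !big_split /= hx; under [RHS]eq_bigr do rewrite mulrBr.
by rewrite sumrB; rewrite /x; ring.
Qed.

(** * Evaluation at the eigenvalues Xi_mu *)

(** The k-th power sum of the d-th roots of unity is d if d divides k, and 0 otherwise. *)
Lemma Xi_p_cons d mu k : (0 < d)%N -> (0 < k)%N ->
  Xi_p (d :: mu) k = Xi_p mu k + (if (d %| k)%N then d%:R else 0).
Proof.
move=> d0 k0; rewrite /Xi_p.
under eq_bigr do rewrite /= mulnDr.
rewrite big_split /= natrD addrC; congr (_ + _).
rewrite big_mkcond; case: ifP => dk.
  rewrite (bigD1_seq d) ?iota_uniq ?mem_index_iota //=; last first.
    by rewrite d0 ltnS dvdn_leq.
  rewrite dk eqxx muln1 big1 ?addn0 // => i /negPf id_.
  by rewrite eq_sym id_ muln0; case: ifP.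
rewrite big1 // => i _; case: ifP => // ik; case: eqP => [di|]; last by rewrite muln0.
by rewrite -di dk in ik.
Qed.

Lemma pleth_Xi_h_cons d mu n : (0 < d)%N ->
  pleth_Xi (h_sym n) (d :: mu) =
  pleth_Xi (h_sym n) mu +
  (if (d <= n)%N then pleth_Xi (h_sym (n - d)) (d :: mu) else 0).
Proof.
move=> d0; rewrite /pleth_Xi.
apply: (@newton_geometric (Xi_p mu) (Xi_p (d :: mu))
  (fun n => sym_eval (Xi_p mu) (h_sym n))
  (fun n => sym_eval (Xi_p (d :: mu)) (h_sym n)) d d0).
- by rewrite !sym_eval_h0.
- by move=> k k0; exact: Xi_p_cons.
- exact: sym_eval_newton.
- exact: sym_eval_newton.
Qed.

(** Geometric expansion of 1/(1 - t^d). The bound K may exceed n, so that one index range serves all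
    factors of a product. *)
Lemma pleth_Xi_h_sum d mu K n : (0 < d)%N -> (n <= K)%N ->
  pleth_Xi (h_sym n) (d :: mu) =
  \sum_(c < K.+1) if (d * c <= n)%N then pleth_Xi (h_sym (n - d * c)) mu else 0.
Proof.
move=> d0; elim: K n => [|K IH] n nK; rewrite pleth_Xi_h_cons //.
  rewrite big_ord_recl big_ord0 muln0 leq0n subn0 (_ : (d <= n)%N = false) //; lia.
rewrite big_ord_recl muln0 leq0n subn0; congr (_ + _).
case: ifP => dn.
  rewrite IH; last by lia.
  apply: eq_bigr => c _; rewrite /= /bump leq0n add1n mulnS subnDA.
  by rewrite -(leq_subRL _ dn).
rewrite big1 // => c _; rewrite /= /bump leq0n add1n mulnS.
by rewrite (_ : (_ <= n)%N = false) //; lia.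
Qed.

Lemma pleth_Xi_count (l K : nat) (v : 'I_l -> nat) mu :
  all (fun x => 0 < x)%N mu -> (forall i, v i <= K)%N ->
  \prod_i pleth_Xi (h_sym (v i)) mu =
  \sum_(B <- assignments {ffun 'I_l -> 'I_K.+1} (size mu))
    [forall i, wsum mu B (fun b => b i : nat) == v i]%:R.
Proof.
elim: mu v => [|d mu IH] v /=.
  move=> _ vK; rewrite big_seq1 /pleth_Xi.
  under eq_bigr => i _.
    rewrite sym_eval_zero; first over.
    by move=> k; rewrite /Xi_p big1 // => j _; rewrite muln0.
  case: (boolP [forall b, _]) => [/forallP h|].
    by rewrite big1 // => b _; move: (h b); rewrite wsum_nil eq_sym => /eqP ->.
  rewrite negb_forall => /existsP [i]; rewrite wsum_nil eq_sym => /negPf nb.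
  by rewrite (bigD1 i) //= nb mul0r.
move=> /andP [d0 amu] vK.
under eq_bigr => i _ do rewrite (pleth_Xi_h_sum mu d0 (vK i)).
(* Expanding the product chooses an exponent c for each letter i; these choices form the block
   assigned to the part d. *)
rewrite bigA_distr_bigA /= big_allpairs_dep big_enum /=.
apply: eq_bigr => f _.
case: (boolP [forall i, (d * f i <= v i)%N]) => [/forallP h|].
  under eq_bigr => i _ do rewrite h.
  rewrite IH //; last by move=> i; have := vK i; lia.
  apply: eq_bigr => B _; congr (nat_of_bool _)%:R; apply: eq_forallb => i.
  by rewrite wsum_cons -(eqn_add2l (d * f i)) subnKC.
rewrite negb_forall => /existsP [i ni]; rewrite (bigD1 i) //= (negPf ni) mul0r.
rewrite big1 // => B _; case: (boolP [forall c, _]) => // /forallP /(_ i).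
by rewrite wsum_cons => /eqP; lia.
Qed.

(** * Assignments of blocks and multiset partitions *)

Lemma nth_le_sumn (s : seq nat) i : (nth 0%N s i <= sumn s)%N.
Proof. by elim: s i => [|p s IH] [|i] //=; [lia | have := IH i; lia]. Qed.

(* An assignment B of blocks to the parts of mu determines the multiset partition
   in which each nonempty block has multiplicity its load. *)
Lemma mset_partition_count (la mu : seq nat) (B : seq (mblock la)) :
  \sum_(pi : mset_of_blocks la | is_mset_partition pi)
    ([forall b, (b != [ffun=> ord0]) ==>
        (wsum mu B (fun c => c == b) == pi b :> nat)]%:R : rat) =
  [forall i : 'I_(size la), wsum mu B (fun b => b i : nat) == nth 0%N la i]%:R.
Proof.
set b0 : mblock la := [ffun=> ord0].
have nz (b : mblock la) : [exists i, b i != ord0] = (b != b0).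
  apply/existsP/idP => [[i]|nb].
    by apply: contraNneq => ->; rewrite ffunE.
  apply/existsP; apply: contraNT nb; rewrite negb_exists => /forallP h.
  by apply/eqP/ffunP => i; rewrite ffunE; move: (h i); rewrite negbK => /eqP.
pose ld b := wsum mu B (fun c => c == b).
have wE (pi : mblock la -> nat) i : pi b0 = 0%N -> (forall b, b != b0 -> ld b = pi b) ->
    wsum mu B (fun b => b i : nat) = (\sum_b pi b * b i)%N.
  move=> p0 h; rewrite wsum_split; apply: eq_bigr => b _.
  case: (eqVneq b b0) => [->|bb]; first by rewrite /b0 ffunE !muln0.
  by rewrite -h.
have pi0 (pi : mset_of_blocks la) : is_mset_partition pi -> pi b0 = ord0.
  move=> /andP [/forallP /(_ b0)]; rewrite nz eqxx implybF negbK.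
  by move=> /eqP.
case: (boolP [forall i, _]) => [/forallP h|nh]; last first.
  rewrite big1 // => pi hpi; case: (boolP [forall b, _]) => // /forallP hb.
  case/negP: nh; apply/forallP => i.
  rewrite (wE (fun b => nat_of_ord (pi b))).
  - by case/andP: hpi => _ /forallP.
  - by rewrite pi0.
  - by move=> b bb; apply/eqP; move: (hb b); rewrite bb.
(* A nonempty block contains some letter i, so its load is at most la_i; hence [inord] below
   preserves the load. *)
have bnd b : b != b0 -> (ld b < (sumn la).+1)%N.
  rewrite -nz => /existsP [i bi]; rewrite ltnS.
  apply: leq_trans (nth_le_sumn la i); move: (h i) => /eqP <-.
  rewrite wsum_split (bigD1 b) //=; apply: leq_trans (leq_addr _ _).
  by rewrite -{1}[ld b]muln1 leq_mul2l lt0n bi orbT.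
pose pi1 : mset_of_blocks la := [ffun b => if b == b0 then ord0 else inord (ld b)].
have pi1E b : b != b0 -> pi1 b = ld b :> nat.
  by move=> bb; rewrite ffunE (negPf bb) inordK // bnd.
have pi10 : pi1 b0 = ord0 by rewrite ffunE eqxx.
rewrite (bigD1 pi1) /=; last first.
  apply/andP; split; last apply/forallP => i.
    apply/forallP => b.
    by rewrite nz; apply/implyP; apply: contraNneq => ->; rewrite pi10.
  rewrite -(wE (fun b => nat_of_ord (pi1 b))) ?pi10 //.
  by move=> b bb; rewrite pi1E.
rewrite big1 ?addr0.
  case: (boolP [forall b, _]) => // /forallP [] b.
  by apply/implyP => bb; rewrite pi1E.
move=> pi /andP [hpi ne]; case: (boolP [forall b, _]) => // /forallP hb.
case/eqP: ne; apply/ffunP => b; apply: val_inj => /=.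
case: (eqVneq b b0) => [->|bb]; first by rewrite pi0 // pi10.
by rewrite pi1E //; apply/esym/eqP; move: (hb b); rewrite bb.
Qed.

Theorem theorem2 (la mu : seq nat)
  (hla : is_partition la) (hmu : is_partition mu) :
  pleth_Xi (h_part la) mu =
  \sum_(pi : mset_of_blocks la | is_mset_partition pi) Hnm (mtilde pi) mu.
Proof.
have amu : all (fun x => 0 < x)%N mu by case/andP: hmu.
transitivity (\sum_(B <- assignments (mblock la) (size mu))
  ([forall i : 'I_(size la), wsum mu B (fun b => b i : nat) == nth 0%N la i]%:R : rat)).
  rewrite -(@pleth_Xi_count _ _ (fun i : 'I_(size la) => nth 0%N la i)) //; last first.
    by move=> i; exact: nth_le_sumn.
  by rewrite /pleth_Xi sym_eval_h_part (big_nth 0%N) big_mkord.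
under eq_bigr do rewrite -mset_partition_count.
(* For each fixed [pi], the assignments with matching loads are counted by [Hnm_count], with the
   empty block as [b0]. *)
rewrite exchange_big /=; apply: eq_bigr => pi hpi.
rewrite -(@Hnm_count _ [ffun=> ord0] (fun b => nat_of_ord (pi b))) //.
case/andP: hpi => /forallP /(_ [ffun=> ord0]) + _ => /implyP h.
apply/eqP; apply: contraT => /h /existsP [i]; by rewrite ffunE.
Qed.
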